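(* Let $U$ be a set and let $(F,G)$ be a Galois connection on the complete lattice $\wp(U)$ (ordered by inclusion). Then there exists a tolerance $R$ on $U$ such that $F(X)=X^{\blacktriangle}$ and $G(X)=X^{\blacktriangledown}$ for all $X\subseteq U$ if and only if the following conditions hold for all $x,y\in U$: (i) $x\in F(\{x\})$; (ii) $x\in F(\{y\})$ implies $y\in F(\{x\})$.
   Context: A Galois connection on an ordered set $P$ is a pair $(f,g)$ of maps $f,g\colon P\to P$ such that for all $p,q\in P$: $f(p)\le q \iff p\le g(q)$. A tolerance on $U$ is a reflexive and symmetric binary relation $R$ on $U$; $R(x)=\{y\in U\mid x\,R\,y\}$. For $X\subseteq U$ (with respect to $R$), $X^{\blacktriangledown}=\{x\in U\mid R(x)\subseteq X\}$ and $X^{\blacktriangle}=\{x\in U\mid R(x)\cap X\neq\emptyset\}$. *)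

(* Defs.v *)
From Stdlib Require Import Relation_Definitions.
From mathcomp Require Import all_boot all_order.
From mathcomp Require Import boolp classical_sets.

Set Implicit Arguments.
Unset Strict Implicit.
Unset Printing Implicit Defensive.

Local Open Scope classical_set_scope.

Definition galois_connection (d : Order.disp_t) (P : porderType d)
    (f g : P -> P) : Prop :=
  forall p q : P, (f p <= q)%O <-> (p <= g q)%O.

(* [ssrbool] shadows [reflexive] and [symmetric] by its versions for
   boolean relations. *)
Definition tolerance (U : Type) (R : relation U) : Prop :=
  Relation_Definitions.reflexive U R /\ Relation_Definitions.symmetric U R.

Definition nbhd (U : Type) (R : relation U) (x : U) : set U := [set y | R x y].

(* $X^{\blacktriangledown}$ *)
Definition lower_approx (U : Type) (R : relation U) (X : set U) : set U :=
  [set x | nbhd R x `<=` X].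

(* $X^{\blacktriangle}$ *)
Definition upper_approx (U : Type) (R : relation U) (X : set U) : set U :=
  [set x | nbhd R x `&` X !=set0].

(* Main.v *)
(* The tolerance is forced: x R y iff x lies in F {y}. Testing the adjunction
   on singletons identifies G with the lower approximation of R, and then F
   and the upper approximation of R are lower adjoints of the same map, hence
   equal. *)
Require Import Defs.
From Stdlib Require Import Relation_Definitions.
From mathcomp Require Import all_boot all_order.
From mathcomp Require Import boolp classical_sets.

Local Open Scope classical_set_scope.

Lemma galois_connection_subset (U : Type) (F G : set U -> set U) :
  galois_connection F G <-> forall X Y : set U, F X `<=` Y <-> X `<=` G Y.
Proof. by split=> FG X Y; have := FG X Y; rewrite !subsetEset. Qed.

(** Both [F X] and [F' X] are the least [Y] such that [G Y] contains [X]. *)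
Lemma lower_adjoint_unique (U : Type) (F F' G : set U -> set U) :
  galois_connection F G -> galois_connection F' G -> F = F'.
Proof.
move=> /galois_connection_subset FG /galois_connection_subset F'G.
apply/funext => X; apply/seteqP; split.
- exact/FG/F'G.
- exact/F'G/FG.
Qed.

(** Each side of the adjunction says that [Y] contains all points related to a point of [X]; the two
    sides read [R] in opposite directions, which symmetry reconciles. *)
Lemma upper_lower_galois (U : Type) (R : relation U) :
  Relation_Definitions.symmetric U R ->
  galois_connection (upper_approx R) (lower_approx R).
Proof.
move=> Rsym; apply/galois_connection_subset => X Y; split.
- by move=> XY x Xx y Rxy; apply: XY; exists x; split=> //; apply: Rsym.
- by move=> XY x [y [Rxy Xy]]; apply: (XY y Xy); apply: Rsym.
Qed.

(** On singletons, this turns conditions (i) and (ii) into reflexivity and symmetry of [R]. *)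
Lemma upper_approx1 (U : Type) (R : relation U) (x y : U) :
  upper_approx R [set y] x <-> R x y.
Proof. by split=> [[z [Rxz <-]]|Rxy]; last exists y. Qed.

(* [set U] carries the library's inclusion order (lemma [subsetEset]). *)
Theorem proposition3p1 (U : Type) (F G : set U -> set U)
    (FG : galois_connection F G) :
  (exists R : relation U, tolerance R /\
     forall X : set U, F X = upper_approx R X /\ G X = lower_approx R X)
  <->
  (forall x y : U,
     (x \in F [set x]) /\ (x \in F [set y] -> y \in F [set x])).
Proof.
split=> [[R [[Rrefl Rsym] FGR]] x y|F1].
  have FE X : F X = upper_approx R X by case: (FGR X).
  rewrite !FE !inE !upper_approx1.
  by split; [exact: Rrefl | exact: Rsym].
pose R : relation U := fun x y => F [set y] x.
have Rrefl : Relation_Definitions.reflexive U R.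
  by move=> x; have [/set_mem] := F1 x x.
have Rsym : Relation_Definitions.symmetric U R.
  by move=> x y Rxy; have [_] := F1 x y; rewrite !inE; apply.
(* Unfolded, the left side collects the [y] with [x] in [F [set y]]; symmetry exchanges [x] and
   [y]. *)
have nbhdE x : nbhd R x = F [set x].
  by apply/seteqP; split=> y; exact: Rsym.
have GE : G = lower_approx R.
  apply/funext => Y; apply/seteqP; split=> x; rewrite /lower_approx /= nbhdE;
    move/galois_connection_subset: FG => FG.
  - by move=> GYx; apply/FG => _ ->.
  - by move=> /FG; apply.
have FE : F = upper_approx R.
  by apply: lower_adjoint_unique FG _; rewrite GE; exact: upper_lower_galois.
by exists R; split=> // X; rewrite {1}FE {1}GE.
Qed.
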